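(* Let $a,b,n$ be positive integers with $a>b$, and define \[ t_0(an,bn,q)'=\sum_{k=an-bn-\lfloor n/2\rfloor}^{an-bn}(-1)^kq^{k^2}\begin{bmatrix} an\\ k\end{bmatrix}_{q^2}\begin{bmatrix} 2an-2k\\ an-bn-k\end{bmatrix}. \] Then \[ t_0(an,bn,q)'\equiv(-1)^{an-bn}q^{(an-bn)^2}\begin{bmatrix} an\\ bn\end{bmatrix}_{q^2}\Big\{1-2(a-b)\big(1-\theta_n(q^{-1})\big)\Big\}\pmod{\Phi_n(q)^2}, \] where \[ \theta_n(q)=\begin{cases} (-1)^m(1+q^m)q^{m(3m-1)/2}, &\text{if } n=3m,\\ (-1)^mq^{m(3m+1)/2}, &\text{if } n=3m+1,\\ (-1)^{m+1}q^{(m+1)(3m+2)/2}, &\text{if } n=3m+2.\end{cases} \]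
   Context: For integers $n,m$, the $q$-binomial coefficient is $\begin{bmatrix} n\\ m\end{bmatrix}_q=\begin{bmatrix} n\\ m\end{bmatrix}=\frac{(1-q^n)(1-q^{n-1})\cdots(1-q^{n-m+1})}{(1-q)(1-q^2)\cdots(1-q^m)}$ if $0\le m\le n$, and $0$ otherwise; $\begin{bmatrix} n\\ m\end{bmatrix}_{q^2}$ is the same with $q$ replaced by $q^2$. $\Phi_n(q)$ denotes the $n$-th cyclotomic polynomial. $\lfloor x\rfloor$ is the integer part of $x$. For rational functions (including Laurent polynomials) $A(q),B(q)$, $A\equiv B\pmod{\Phi_n(q)^2}$ means $A-B=\Phi_n(q)^2P(q)/Q(q)$ with $P,Q\in\mathbb{Z}[q]$ and $Q$ coprime to $\Phi_n(q)$. *)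

(* Defs.v *)
From HB Require Import structures.
From mathcomp Require Import all_boot all_order all_algebra all_field.
From mathcomp Require Import fraction.

Set Implicit Arguments.
Unset Strict Implicit.
Unset Printing Implicit Defensive.

Import GRing.Theory.
Local Open Scope ring_scope.

Notation "x %:F" := (FracField.tofrac x) : ring_scope.

(* The field of fractions of Z[q], i.e. the rational functions over Q. *)
Notation ratfun := {fraction {poly int}}.

Definition qvar : ratfun := 'X%:F.

Definition qbinom (F : fieldType) (q : F) (n m : nat) : F :=
  if (m <= n)%N then
    (\prod_(0 <= i < m) (1 - q ^+ (n - i))) /
    (\prod_(1 <= i < m.+1) (1 - q ^+ i))
  else 0.

(* The halves in the exponents are exact: each product is even. *)
Definition theta (F : fieldType) (n : nat) (q : F) : F :=
  let m := (n %/ 3)%N in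
  match (n %% 3)%N with
  | 0 => (-1) ^+ m * (1 + q ^+ m) * q ^+ ((m * (3 * m - 1)) %/ 2)%N
  | 1 => (-1) ^+ m * q ^+ ((m * (3 * m + 1)) %/ 2)%N
  | _ => (-1) ^+ m.+1 * q ^+ ((m.+1 * (3 * m + 2)) %/ 2)%N
  end.

(* Truncated subtractions are harmless when b < a: then
   n./2 <= n <= a * n - b * n, and k <= a * n - b * n <= a * n in the sum. *)
Definition t0' (F : fieldType) (a b n : nat) (q : F) : F :=
  \sum_((a * n - b * n - n./2)%N <= k < (a * n - b * n).+1)
     (-1) ^+ k * q ^+ (k ^ 2)%N * qbinom (q ^+ 2) (a * n) k
     * qbinom q (2 * (a * n) - 2 * k) (a * n - b * n - k).

(* Coprimality in {poly int} here means that the gcd is a nonzero constant,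
   i.e. coprimality over Q; as 'Phi_n is monic this is the same as having no
   common divisor other than 1 and -1 in Z[q].  For n > 0 it forces Q != 0. *)
Definition eqmod_Phi2 (n : nat) (A B : ratfun) : Prop :=
  exists P Q : {poly int},
    coprimep Q 'Phi_n /\ A - B = ('Phi_n ^+ 2)%:F * P%:F / Q%:F.

(* Main.v *)
(** Put M = (a - b) n and k = M - j.  The j = 0 term T of the sum is the main
    term of the congruence.  For 1 <= j <= n/2 the j-th term is
    T (1 - q^(2M)) A_j, with A_j free of Phi_n in its denominator; for j = n/2
    this uses that 1 - q^(2bn+2j) cancels between the two q-binomials.
    On the other side theta_n(p), for p = 1/q, has the exact expansion
      sum_k (-1)^k p^(k(k-1)/2) (1 - p^n)/(1 - p^(n-k)) [n-k choose k]_p,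
    whose j-th term is (1 - p^n) B_j for j >= 1.  Since q^n = 1 modulo Phi_n,
    A_j = - B_j modulo Phi_n, and 1 - q^(2M) = -2(a-b) (1 - p^n) modulo Phi_n^2. *)
Require Import Defs.
From HB Require Import structures.
From mathcomp Require Import all_boot all_order all_algebra all_field.
From mathcomp Require Import fraction.
From mathcomp Require Import zify ring.

Set Implicit Arguments.
Unset Strict Implicit.
Unset Printing Implicit Defensive.

Import GRing.Theory.
Local Open Scope ring_scope.

(** Makes every q-factorial invertible; it is applied to q, q^2 and 1/q. *)
Definition not_unity_root (F : fieldType) (q : F) : Prop :=
  forall i, (0 < i)%N -> 1 - q ^+ i != 0.

(** * q-factorials and the q-Pascal rules *)

Section QBinomial.

Variables (F : fieldType) (q : F).
Hypothesis qP : not_unity_root q.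

Definition qfact (n : nat) : F := \prod_(1 <= i < n.+1) (1 - q ^+ i).

Lemma qfact_neq0 n : qfact n != 0.
Proof.
rewrite /qfact big_nat_cond prodf_seq_neq0; apply/allP => i _ /=.
by apply/implyP => /andP[/andP[i_gt0 _] _]; apply: qP.
Qed.

Lemma qfactS n : qfact n.+1 = qfact n * (1 - q ^+ n.+1).
Proof. by rewrite /qfact big_nat_recr. Qed.

Lemma qfactB n m : (m <= n)%N ->
  qfact n = qfact (n - m) * \prod_(0 <= i < m) (1 - q ^+ (n - i)).
Proof.
elim: m => [|m IHm] lt_mn; first by rewrite subn0 big_geq ?mulr1.
rewrite big_nat_recr //= IHm ?(ltnW lt_mn) //.
have -> : (n - m = (n - m.+1).+1)%N by lia.
by rewrite qfactS; ring.
Qed.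

Lemma qfactD n m :
  qfact (n + m) = qfact n * \prod_(1 <= i < m.+1) (1 - q ^+ (n + i)).
Proof.
elim: m => [|m IHm]; first by rewrite addn0 big_geq ?mulr1.
by rewrite addnS qfactS IHm [in RHS]big_nat_recr //= mulrA addnS.
Qed.

Lemma qbinom_qfact n m : (m <= n)%N ->
  qbinom q n m = qfact n / (qfact m * qfact (n - m)).
Proof.
move=> le_mn; rewrite /qbinom le_mn (qfactB le_mn).
rewrite -/(qfact m); move: (\prod_(_ <= _ < m) _) => P.
by have := qfact_neq0 m; have := qfact_neq0 (n - m) => h1 h2; field; rewrite h1 h2.
Qed.

Lemma qbinom_small n m : (n < m)%N -> qbinom q n m = 0.
Proof. by rewrite /qbinom ltnNge => /negPf ->. Qed.

Lemma qbinomn0 n : qbinom q n 0 = 1.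
Proof. by rewrite /qbinom /= !big_geq ?divr1. Qed.

Lemma qbinomnn n : qbinom q n n = 1.
Proof.
by rewrite qbinom_qfact // subnn {3}/qfact big_geq // mulr1 divff ?qfact_neq0.
Qed.

(** Over a common denominator this is 1 - q^(n+1) = q^(m+1) (1 - q^(n-m)) + (1 - q^(m+1));
    [qbinomS'] uses the splitting (1 - q^(n-m)) + q^(n-m) (1 - q^(m+1)). *)
Lemma qbinomS n m :
  qbinom q n.+1 m.+1 = q ^+ m.+1 * qbinom q n m.+1 + qbinom q n m.
Proof.
have [lt_nm|] := ltnP n m; first by rewrite !qbinom_small ?mulr0 ?addr0 //; lia.
rewrite leq_eqVlt => /orP[/eqP->|lt_mn].
  by rewrite !qbinomnn qbinom_small // mulr0 add0r.
have [d ->] : exists d, n = (m + d.+1)%N by exists (n - m.+1)%N; lia.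
rewrite !qbinom_qfact; try lia.
have -> : ((m + d.+1).+1 - m.+1 = d.+1)%N by lia.
have -> : (m + d.+1 - m.+1 = d)%N by lia.
have -> : (m + d.+1 - m = d.+1)%N by lia.
rewrite !qfactS.
have := qfact_neq0 m; have := qfact_neq0 d; have := qP (ltn0Sn d); have := qP (ltn0Sn m).
have -> : q ^+ (m + d.+1).+1 = q ^+ m.+1 * q ^+ d.+1 by rewrite -exprD addSn.
by move=> h1 h2 h3 h4; field; rewrite ?h1 ?h2 ?h3 ?h4.
Qed.

Lemma qbinomS' n m : (m <= n)%N ->
  qbinom q n.+1 m.+1 = qbinom q n m.+1 + q ^+ (n - m) * qbinom q n m.
Proof.
rewrite leq_eqVlt => /orP[/eqP->|lt_mn].
  by rewrite !qbinomnn qbinom_small // subnn expr0 mul1r add0r.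
have [d ->] : exists d, n = (m + d.+1)%N by exists (n - m.+1)%N; lia.
rewrite !qbinom_qfact; try lia.
have -> : ((m + d.+1).+1 - m.+1 = d.+1)%N by lia.
have -> : (m + d.+1 - m.+1 = d)%N by lia.
have -> : (m + d.+1 - m = d.+1)%N by lia.
rewrite !qfactS.
have := qfact_neq0 m; have := qfact_neq0 d; have := qP (ltn0Sn d); have := qP (ltn0Sn m).
have -> : q ^+ (m + d.+1).+1 = q ^+ m.+1 * q ^+ d.+1 by rewrite -exprD addSn.
by move=> h1 h2 h3 h4; field; rewrite ?h1 ?h2 ?h3 ?h4.
Qed.

(** From 1 - q^(n+m+2) = (1 - q^(n+1)) + q^(n+1) (1 - q^(m+1)). It absorbs the quotients in [qluc]
    into q-binomials. *)
Lemma qbinom_diag n m : (m <= n)%N ->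
  (1 - q ^+ (n + m.+1).+1) / (1 - q ^+ n.+1) * qbinom q n.+1 m.+1
  = qbinom q n.+1 m.+1 + q ^+ n.+1 * qbinom q n m.
Proof.
move=> le_mn; have [d ->] : exists d, n = (m + d)%N by exists (n - m)%N; lia.
rewrite !qbinom_qfact; try lia.
have -> : ((m + d).+1 - m.+1 = d)%N by lia.
have -> : (m + d - m = d)%N by lia.
rewrite !qfactS.
have := qfact_neq0 m; have := qfact_neq0 d; have := qP (ltn0Sn (m + d)); have := qP (ltn0Sn m).
have -> : q ^+ (m + d + m.+1).+1 = q ^+ (m + d).+1 * q ^+ m.+1 by rewrite -exprD addSn.
by move=> h1 h2 h3 h4; field; rewrite ?h1 ?h2 ?h3 ?h4.
Qed.

(** * Signed q-Fibonacci and q-Lucas sums and their pentagonal evaluation *)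

Definition qfib (n : nat) : F :=
  \sum_(0 <= k < n.+1) (-1) ^+ k * q ^+ 'C(k, 2) * qbinom q (n - k) k.

Definition qfib' (n : nat) : F :=
  \sum_(0 <= k < n.+1) (-1) ^+ k * q ^+ 'C(k.+1, 2) * qbinom q (n - k) k.

(** Signed q-analogue of the Lucas numbers sum_k n/(n-k) C(n-k,k). For n > 0 the zero denominator at
    k = n is harmless, since the q-binomial there is 0. *)
Definition qluc (n : nat) : F :=
  \sum_(0 <= k < n.+1) (-1) ^+ k * q ^+ 'C(k, 2)
     * ((1 - q ^+ n) / (1 - q ^+ (n - k)) * qbinom q (n - k) k).

(** After the shift of k, a sum of index n+2 gets the range of a sum of index n, so that recurrences
    can be checked term by term. *)
Lemma sum_peel (f : nat -> F) n : f n.+2 = 0 ->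
  \sum_(0 <= k < n.+3) f k = f 0%N + \sum_(0 <= k < n.+1) f k.+1.
Proof. by move=> f0; rewrite big_nat_recr //= f0 addr0 big_nat_recl. Qed.

(* The two forms of the q-Pascal rule, applied to [qfib] and [qfib'], give
   recurrences which together close up with step 3 and yield the pentagonal
   exponents of [theta]. *)
Lemma qfib_rec n : qfib n.+2 = qfib' n.+1 - qfib' n.
Proof.
rewrite /qfib sum_peel; last by rewrite qbinom_small ?mulr0 //; lia.
rewrite [qfib' n.+1]/qfib' [in RHS]big_nat_recl //= !qbinomn0 -addrA; congr (_ + _).
rewrite /qfib' -sumrB; apply: eq_big_nat => k /andP[_ lt_kn].
have -> : (n.+2 - k.+1 = (n - k).+1)%N by lia.
rewrite qbinomS subSS [in 'C(k.+2, 2)]binS bin1 exprD exprS.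
ring.
Qed.

Lemma qfib'_rec n : qfib' n.+2 = qfib' n.+1 - q ^+ n.+1 * qfib n.
Proof.
rewrite {1}/qfib' sum_peel; last by rewrite qbinom_small ?mulr0 //; lia.
rewrite [qfib' n.+1]/qfib' [in RHS]big_nat_recl //= !qbinomn0 -addrA; congr (_ + _).
rewrite /qfib big_distrr /= -sumrB; apply: eq_big_nat => k /andP[_ lt_kn].
have -> : (n.+2 - k.+1 = (n - k).+1)%N by lia.
have [le_k|lt_k] := leqP k (n - k); last first.
  by rewrite subSS !(qbinom_small (n := _ - _)) ?qbinom_small ?mulr0 ?subr0 //; lia.
rewrite qbinomS' // subSS mulrDr exprS !mulN1r !mulNr mulrA; congr (_ - _).
(* The factor q^(n-2k) from the q-Pascal rule completes the exponent to n+1 + C(k,2), so that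
   q^(n+1) comes out of the sum. *)
have -> : ('C(k.+2, 2) = n.+1 + 'C(k, 2) - (n - k - k))%N.
  by rewrite !binS !bin1 bin0; lia.
have : (n - k - k <= n.+1 + 'C(k, 2))%N by lia.
move=> /subnK h; rewrite !mulrA -(mulrA ((-1) ^+ k)) -exprD h exprD; ring.
Qed.

(** [qbinom_diag] splits each term; in the second part q^(n+1-k) and the factor q^k of q^C(k+1,2)
    combine to q^(n+1), free of k. *)
Lemma qluc_rec n : qluc n.+2 = qfib n.+2 - q ^+ n.+1 * qfib n.
Proof.
rewrite /qluc sum_peel; last by rewrite qbinom_small ?mulr0 //; lia.
rewrite {1}/qfib sum_peel; last by rewrite qbinom_small ?mulr0 //; lia.
rewrite !qbinomn0 subn0 divff ?qP // !mulr1 -addrA; congr (_ + _).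
rewrite /qfib big_distrr /= -sumrB; apply: eq_big_nat => k /andP[_ lt_kn].
have -> : (n.+2 - k.+1 = (n - k).+1)%N by lia.
have [le_k|lt_k] := leqP k (n - k); last first.
  by rewrite !qbinom_small ?mulr0 ?subr0 //; lia.
have -> : n.+2 = (n - k + k.+1).+1 by lia.
rewrite qbinom_diag // binS bin1 exprD.
have -> : n.+1 = (k + (n - k).+1)%N by lia.
by rewrite exprD !exprS; ring.
Qed.

Lemma qfib_rec3 n : qfib n.+3 = - q ^+ n.+1 * qfib n.
Proof. by rewrite qfib_rec qfib'_rec; ring. Qed.

(** Iterates [qfib_rec3] from the initial values 1, 1, 0. The exponents are the pentagonal numbers
    m(3m-1)/2 and m(3m+1)/2, written without division. *)
Lemma qfib_mod3 m :
  [/\ qfib (3 * m) = (-1) ^+ m * q ^+ (3 * 'C(m, 2) + m),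
      qfib (3 * m).+1 = (-1) ^+ m * q ^+ (3 * 'C(m, 2) + 2 * m)
    & qfib (3 * m).+2 = 0].
Proof.
elim: m => [|m [IH0 IH1 IH2]].
  rewrite muln0 /qfib; split.
  - by rewrite big_nat1 qbinomn0 !mulr1.
  - by rewrite big_nat_recr // big_nat1 qbinomn0 qbinom_small // mulr0 /= addr0 !mulr1.
  - rewrite (sum_peel (n := 0)); last by rewrite qbinom_small ?mulr0.
    rewrite big_nat1 qbinomn0 qbinomnn.
    by rewrite expr1 !expr0 !mulr1 addrN.
have -> : (3 * m.+1 = (3 * m).+3)%N by lia.
rewrite !qfib_rec3 IH0 IH1 IH2 mulr0 binS bin1; split=> //.
  have -> : (3 * ('C(m, 2) + m) + m.+1 = (3 * m).+1 + (3 * 'C(m, 2) + m))%N by lia.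
  by rewrite (exprD _ (3 * m).+1) (exprS (-1)); ring.
have -> : (3 * ('C(m, 2) + m) + 2 * m.+1 = (3 * m).+2 + (3 * 'C(m, 2) + 2 * m))%N by lia.
by rewrite (exprD _ (3 * m).+2) (exprS (-1)); ring.
Qed.

Lemma mul2_bin2 m : (2 * 'C(m, 2) = m * m.-1)%N.
Proof. by elim: m => //= m IHm; rewrite binS bin1 mulnDr IHm; nia. Qed.

(** By [qluc_rec] only [qfib] at n and n-2 matter. Both survive when 3 divides n, whence the factor
    1 + q^m; otherwise exactly one of them vanishes. *)
Lemma qlucE n : (0 < n)%N -> qluc n = theta n q.
Proof.
rewrite /theta {1 2}(divn_eq n 3) => n_gt0.
have := ltn_pmod n (isT : (0 < 3)%N).
move: n_gt0; set m := (n %/ 3)%N; rewrite mulnC; move: m.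
case: (n %% 3)%N => [|[|[|//]]] m n_gt0 _.
- case: m n_gt0 => // m _.
  have -> : (3 * m.+1 + 0 = (3 * m).+1.+2)%N by lia.
  rewrite qluc_rec.
  have -> : (3 * m).+3 = (3 * m.+1)%N by lia.
  have [-> _ _] := qfib_mod3 m.+1; have [_ -> _] := qfib_mod3 m.
  have -> : ((m.+1 * (3 * m.+1 - 1)) %/ 2 = 3 * 'C(m.+1, 2) + m.+1)%N.
    by have := mul2_bin2 m.+1; move: ('C(m.+1, 2)) => c /= h; nia.
  rewrite binS bin1.
  (* Relates the two surviving values of [qfib], up to sign, by the factor q^(m+1). *)
  have h : q ^+ (3 * m).+2 * q ^+ (3 * 'C(m, 2) + 2 * m)
           = q ^+ m.+1 * q ^+ (3 * ('C(m, 2) + m) + m.+1).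
    by rewrite -!exprD; congr (_ ^+ _); lia.
  by rewrite mulrCA h !(exprS (-1)); ring.
(* The recurrence starts at n = 2, so n = 1 is computed directly. *)
- case: m n_gt0 => [|m] _.
    rewrite muln0 add0n /qluc big_nat_recr // big_nat1 qbinomn0 qbinom_small //.
    by rewrite !mulr0 /= addr0 subn0 divff ?qP // !expr0 !mulr1.
  have -> : qluc (3 * m.+1 + 1) = qluc (3 * m).+4 by congr qluc; lia.
  rewrite qluc_rec.
  have -> : (3 * m).+4 = (3 * m.+1).+1%N by lia.
  have [_ -> _] := qfib_mod3 m.+1; have [_ _ ->] := qfib_mod3 m.
  have -> : ((m.+1 * (3 * m.+1 + 1)) %/ 2 = 3 * 'C(m.+1, 2) + 2 * m.+1)%N.
    by have := mul2_bin2 m.+1; move: ('C(m.+1, 2)) => c /= h; nia.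
  by rewrite mulr0 subr0.
- rewrite [qluc _](_ : _ = qluc (3 * m).+2) ; last by rewrite addn2.
  rewrite qluc_rec; have [-> _ ->] := qfib_mod3 m.
  have -> : ((m.+1 * (3 * m + 2)) %/ 2 = (3 * m).+1 + (3 * 'C(m, 2) + m))%N.
    by have := mul2_bin2 m; move: ('C(m, 2)) => c /= h; case: m h {n_gt0} => //= m; nia.
  by rewrite sub0r (exprD q (3 * m).+1) (exprS (-1)); ring.
Qed.

End QBinomial.

(** * Ratio of a term of the sum to the main term *)

(** The power of q comes from (M-j)^2 = M^2 - 2Mj + j^2. The quotient of the q^2-binomials supplies
    1 - q^(2M), and its denominator factor 1 - q^(2(B+j)) cancels the leading numerator factor of
    the other q-binomial. *)
Lemma qbinom_term_ratio (F : fieldType) (q : F) (B M j : nat) :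
  q != 0 -> not_unity_root q -> not_unity_root (q ^+ 2) ->
  (0 < j)%N -> (j <= M)%N ->
  (-1) ^+ (M - j) * q ^+ ((M - j) ^ 2)%N * qbinom (q ^+ 2) (B + M) (M - j)
     * qbinom q (2 * (B + M) - 2 * (M - j)) (M - (M - j))
  = (-1) ^+ M * q ^+ (M ^ 2)%N * qbinom (q ^+ 2) (B + M) B
     * ((1 - q ^+ (2 * M))
        * ((-1) ^+ j * q ^+ (j ^ 2)%N * q^-1 ^+ (2 * M * j)
           * \prod_(1 <= i < j)
               ((1 - q ^+ (2 * (M - i))) * (1 - q ^+ (2 * B + j + i))
                / ((1 - q ^+ (2 * (B + i))) * (1 - q ^+ i)))
           / (1 - q ^+ j))).
Proof.
move=> q0 qP q2P j_gt0 le_jM.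
have -> : (-1) ^+ (M - j) = (-1) ^+ M * (-1) ^+ j :> F.
  by rewrite -{2}(subnK le_jM) exprD -mulrA -expr2 sqrr_sign mulr1.
have -> : q ^+ ((M - j) ^ 2)%N = q ^+ (M ^ 2)%N * q ^+ (j ^ 2)%N * q^-1 ^+ (2 * M * j).
  rewrite exprVn; apply: (canRL (mulfK _)); first exact: expf_neq0.
  by rewrite -!exprD; congr (_ ^+ _); nia.
rewrite !(qbinom_qfact q2P); try lia.
have -> : (B + M - (M - j) = B + j)%N by lia.
have -> : (B + M - B = M)%N by lia.
rewrite subKn // /qbinom ifT; last by lia.
have -> : (2 * (B + M) - 2 * (M - j) = 2 * B + 2 * j)%N by lia.
have E1 : \prod_(0 <= i < j) (1 - q ^+ (2 * B + 2 * j - i))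
          = (1 - q ^+ (2 * (B + j))) * \prod_(1 <= i < j) (1 - q ^+ (2 * B + j + i)).
  rewrite big_ltn // subn0 mulnDr big_nat_rev /=; congr (_ * _).
  by apply: eq_big_nat => i hi; congr (1 - q ^+ _); lia.
have E2 : \prod_(0 <= i < j) (1 - (q ^+ 2) ^+ (M - i))
          = (1 - q ^+ (2 * M)) * \prod_(1 <= i < j) (1 - q ^+ (2 * (M - i))).
  by under eq_bigr do rewrite -exprM; rewrite big_ltn // subn0.
have E3 : \prod_(1 <= i < j.+1) (1 - (q ^+ 2) ^+ (B + i))
          = \prod_(1 <= i < j) (1 - q ^+ (2 * (B + i))) * (1 - q ^+ (2 * (B + j))).
  by under eq_bigr do rewrite -exprM; rewrite big_nat_recr.
have E4 : \prod_(1 <= i < j.+1) (1 - q ^+ i)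
          = \prod_(1 <= i < j) (1 - q ^+ i) * (1 - q ^+ j) by rewrite big_nat_recr.
have prod0 (f : nat -> nat) : (forall i, 0 < i -> 0 < f i)%N ->
    \prod_(1 <= i < j) (1 - q ^+ f i) != 0.
  move=> f_gt0; rewrite big_nat_cond prodf_seq_neq0; apply/allP => i _.
  by apply/implyP => /andP[/andP[i_gt0 _] _]; apply/qP/f_gt0.
rewrite (qfactB (q ^+ 2) le_jM) (qfactD _ B j) E1 E2 E3 E4 prodf_div !big_split /=.
have h1 := prod0 (fun i => i) (fun _ h => h).
have h2 : \prod_(1 <= i < j) (1 - q ^+ (2 * (B + i))) != 0 by apply: prod0 => i; lia.
have h3 := qP _ j_gt0.
have h4 : 1 - q ^+ (2 * (B + j)) != 0 by apply: qP; lia.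
have h5 := qfact_neq0 q2P B; have h6 := qfact_neq0 q2P (M - j).
(* These factors sit in the denominator through the q-factorial of M. Since 2(M-i) is positive only
   for i < M, [prod0] does not apply. *)
have h7 : (1 - q ^+ (2 * M)) * \prod_(1 <= i < j) (1 - q ^+ (2 * (M - i))) != 0.
  rewrite -E2 big_nat_cond prodf_seq_neq0; apply/allP => i _.
  by apply/implyP => /andP[/andP[_ lt_ij] _]; apply: q2P; lia.
move: h7; rewrite mulf_eq0 negb_or => /andP[h7 h8].
move: (\prod_(1 <= i < j) (1 - q ^+ (2 * (M - i)))) h8 => P1 h8.
move: (\prod_(1 <= i < j) (1 - q ^+ (2 * B + j + i))) => P2.
move: (\prod_(1 <= i < j) (1 - q ^+ (2 * (B + i)))) h2 => P3 h2.
move: (\prod_(1 <= i < j) (1 - q ^+ i)) h1 => P4 h1.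
move: (q ^+ (2 * M)) h7 (q ^+ (2 * (B + j))) h4 (q ^+ j) h3 => x1 h7 x2 h4 x3 h3.
move: (q^-1 ^+ _) (q ^+ (M ^ 2)%N) (q ^+ (j ^ 2)%N) => y1 y2 y3.
move: (qfact _ _) (qfact _ _) h5 (qfact _ _) h6 => Q1 Q2 h5 Q3 h6.
by field; rewrite ?h1 ?h2 ?h3 ?h4 ?h5 ?h6 ?h7 ?h8.
Qed.

(** * Coprimality to ['Phi_n] and the localization of Z[q] *)

(** A nonconstant gcd would have a root in [algC], which is a root of ['Phi_n], hence a primitive
    n-th root of unity, and also a root of Q. *)
Lemma coprimep_Cyclotomic (n : nat) (Q : {poly int}) : (0 < n)%N ->
  (forall z : algC, n.-primitive_root z -> ~~ root (map_poly intr Q) z) ->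
  coprimep Q 'Phi_n.
Proof.
move=> n_gt0 Qz; have [z0 z0P] := C_prim_root_exists n_gt0.
apply: contraT => ncop.
have gcd_map (p : {poly int}) (d := gcdp Q 'Phi_n) (z : algC) :
    d %| p -> root (map_poly intr d) z -> root (map_poly intr p) z.
  (* Divisibility over Z only gives c p = r d with a nonzero integer c, which does not affect
     roots. *)
  move=> /Pdiv.Idomain.dvdpP[[c r] /= c0 /(congr1 (map_poly (intr : int -> algC)))].
  rewrite rmorphM /= map_polyZ /= => def_p /eqP dz.
  have : root (c%:~R *: map_poly intr p) z by rewrite def_p rootM orbC /root dz eqxx.
  by rewrite rootZ ?intr_eq0.
have [z dz] : exists z, root (map_poly (intr : int -> algC) (gcdp Q 'Phi_n)) z.
  apply/closed_rootP; rewrite size_map_inj_poly ?rmorph0 //; exact: intr_inj.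
have := gcd_map _ _ (dvdp_gcdr _ _) dz; rewrite (Cintr_Cyclotomic z0P) root_cyclotomic //.
by move=> /Qz /negP[]; apply: gcd_map dz; apply: dvdp_gcdl.
Qed.

(* The field is kept abstract: [field] diverges on the concrete [ratfun]. *)
Section LocalRing.

Variables (F : fieldType) (emb : {rmorphism {poly int} -> F}) (n : nat).
Hypotheses (emb_inj : injective emb) (n_gt0 : (0 < n)%N).

Let q := emb 'X.
Let p := q^-1.

Lemma emb_eq0 P : (emb P == 0) = (P == 0).
Proof. by rewrite -(rmorph0 emb) (inj_eq emb_inj). Qed.

Lemma not_unity_root_qvar : not_unity_root q.
Proof.
move=> i i_gt0; rewrite -(rmorph1 emb) -rmorphXn -rmorphB emb_eq0 subr_eq0.
apply: contraTneq i_gt0 => /(congr1 (size : {poly int} -> nat)).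
by rewrite size_poly1 size_polyXn => -[<-].
Qed.

Lemma qvar_neq0 : q != 0.
Proof. by rewrite emb_eq0 polyX_eq0. Qed.

Lemma not_unity_root_qvarV : not_unity_root p.
Proof.
move=> i /not_unity_root_qvar; apply: contra => /eqP h; rewrite subr_eq0 eq_sym -invr_eq1.
by rewrite -exprVn eq_sym -subr_eq0 h.
Qed.

Lemma not_unity_root_qvar2 : not_unity_root (q ^+ 2).
Proof. by move=> i i_gt0; rewrite -exprM not_unity_root_qvar // muln_gt0. Qed.

(* Membership in the localization of Z[q] at the polynomials coprime to Phi_n,
   where eqmod_Phi2 is congruence modulo the ideal Phi_n^2. *)
Definition local (x : F) : Prop :=
  exists P Q : {poly int}, coprimep Q 'Phi_n /\ x = emb P / emb Q.

Lemma coprimep_Phi_neq0 (Q : {poly int}) : coprimep Q 'Phi_n -> emb Q != 0.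
Proof.
rewrite emb_eq0; apply: contraTneq => ->.
by rewrite coprime0p -size_poly_eq1 size_Cyclotomic eqSS -lt0n totient_gt0.
Qed.

Lemma local_emb (P : {poly int}) : local (emb P).
Proof. by exists P, 1; rewrite coprime1p rmorph1 divr1. Qed.

Lemma local_inv_coprime (Q : {poly int}) : coprimep Q 'Phi_n -> local (emb Q)^-1.
Proof. by exists 1, Q; rewrite rmorph1 mul1r. Qed.

Lemma localM x y : local x -> local y -> local (x * y).
Proof.
move=> [P [Q [cQ ->]]] [P' [Q' [cQ' ->]]]; exists (P * P'), (Q * Q').
by rewrite coprimepMl cQ cQ' !rmorphM mulf_div.
Qed.

Lemma localD x y : local x -> local y -> local (x + y).
Proof.
move=> [P [Q [cQ ->]]] [P' [Q' [cQ' ->]]]; exists (P * Q' + P' * Q), (Q * Q').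
by rewrite coprimepMl cQ cQ' rmorphD !rmorphM addf_div ?coprimep_Phi_neq0.
Qed.

Lemma local_int (c : int) : local c%:~R.
Proof. by have := local_emb c%:~R; rewrite rmorph_int. Qed.

Lemma local0 : local 0. Proof. exact: (local_int 0). Qed.
Lemma local1 : local 1. Proof. exact: (local_int 1). Qed.

Lemma localN x : local x -> local (- x).
Proof. by move=> lx; rewrite -mulN1r; apply: localM lx; apply: (local_int (- 1)). Qed.

Lemma localB x y : local x -> local y -> local (x - y).
Proof. by move=> lx ly; apply/localD/localN. Qed.

Lemma localX x k : local x -> local (x ^+ k).
Proof.
move=> lx; elim: k => [|k IHk]; first exact: local1.
by rewrite exprS; apply: localM.
Qed.

Lemma local_qvar : local q. Proof. exact: local_emb. Qed.

Lemma local_qvarV : local p.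
Proof.
apply: local_inv_coprime; apply: coprimep_Cyclotomic => // z zP.
rewrite map_polyX rootX; apply/eqP => z0; have /eqP := prim_expr_order zP.
by rewrite z0 expr0n gtn_eqF // eq_sym oner_eq0.
Qed.

(** A primitive n-th root z has z^i = 1 only if n divides i. *)
Lemma local_unit i : ~~ (n %| i)%N -> local (1 - q ^+ i)^-1.
Proof.
move=> ndi; rewrite -rmorphXn -(rmorph1 emb) -rmorphB.
apply: local_inv_coprime; apply: coprimep_Cyclotomic => // z zP.
rewrite rmorphB rmorph1 /= map_polyXn /root !hornerE subr_eq0 eq_sym.
by rewrite -(prim_order_dvd zP).
Qed.

(** The denominator of the defining quotient may be divisible by ['Phi_n]; the q-Pascal rule avoids
    it by building the value from powers of q. *)
Lemma local_qbinom2 N k : local (qbinom (q ^+ 2) N k).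
Proof.
elim: N k => [|N IHN] [|k]; rewrite ?qbinomn0; try exact: local1.
  by rewrite qbinom_small //; exact: local0.
rewrite (qbinomS not_unity_root_qvar2).
by apply: localD => //; apply: localM => //; do 2!apply: localX; apply: local_qvar.
Qed.

(** * Powers of the ideal generated by [Phi], and congruence modulo [Phi] *)

Definition Phi : F := emb 'Phi_n.

Definition idealPhi (k : nat) (x : F) : Prop := exists2 y, local y & x = Phi ^+ k * y.

Lemma idealPhiD k x y : idealPhi k x -> idealPhi k y -> idealPhi k (x + y).
Proof. by move=> [u lu ->] [v lv ->]; exists (u + v); [apply: localD | rewrite mulrDr]. Qed.

Lemma idealPhiM k x y : idealPhi k x -> local y -> idealPhi k (x * y).
Proof. by move=> [u lu ->] ly; exists (u * y); [apply: localM | rewrite mulrA]. Qed.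

Lemma idealPhi_mul k l x y : idealPhi k x -> idealPhi l y -> idealPhi (k + l) (x * y).
Proof.
by move=> [u lu ->] [v lv ->]; exists (u * v); [apply: localM | rewrite exprD; ring].
Qed.

Lemma idealPhi_sum k (r : seq nat) (f : nat -> F) :
  (forall i, i \in r -> idealPhi k (f i)) -> idealPhi k (\sum_(i <- r) f i).
Proof.
move=> If; rewrite big_seq; apply: big_ind => //; last exact: idealPhiD.
by exists 0; [exact: local0 | rewrite mulr0].
Qed.

Lemma idealPhi_1subXn : idealPhi 1 (1 - q ^+ n).
Proof.
have [R def_R] : exists R : {poly int}, 'X^n - 1 = 'Phi_n * R.
  rewrite -(prod_Cyclotomic n_gt0) (perm_big _ (perm_to_rem (_ : n \in divisors n))).
    by rewrite big_cons; eexists.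
  by rewrite -dvdn_divisors.
exists (- emb R); first exact/localN/local_emb.
by rewrite mulrN -rmorphM -def_R rmorphB rmorphXn rmorph1 opprB.
Qed.

(** Locality of both sides is included so that congruences can be multiplied. *)
Definition eqPhi (x y : F) : Prop := [/\ local x, local y & idealPhi 1 (x - y)].

Lemma eqPhi_refl x : local x -> eqPhi x x.
Proof. by move=> lx; split=> //; exists 0; [exact: local0 | rewrite subrr mulr0]. Qed.

Lemma eqPhi_sym x y : eqPhi x y -> eqPhi y x.
Proof.
move=> [lx ly [u lu h]]; split=> //; exists (- u); first exact: localN.
by rewrite -opprB h mulrN.
Qed.

Lemma eqPhiM x y x' y' : eqPhi x x' -> eqPhi y y' -> eqPhi (x * y) (x' * y').
Proof.
move=> [lx lx' h] [ly ly' h']; split; try exact: localM.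
have -> : x * y - x' * y' = (x - x') * y + (y - y') * x' by ring.
by apply: idealPhiD; apply: idealPhiM.
Qed.

Lemma eqPhiD x y x' y' : eqPhi x x' -> eqPhi y y' -> eqPhi (x + y) (x' + y').
Proof.
move=> [lx lx' h] [ly ly' h']; split; try exact: localD.
by rewrite opprD addrACA; apply: idealPhiD.
Qed.

Lemma eqPhiN x y : eqPhi x y -> eqPhi (- x) (- y).
Proof.
by move=> h; rewrite -[- x]mulN1r -[- y]mulN1r; apply: eqPhiM h; apply/eqPhi_refl/localN/local1.
Qed.

Lemma eqPhiB x y x' y' : eqPhi x x' -> eqPhi y y' -> eqPhi (x - y) (x' - y').
Proof. by move=> h h'; apply: eqPhiD h _; apply: eqPhiN. Qed.

Lemma eqPhiV x y : x != 0 -> y != 0 -> local x^-1 -> local y^-1 ->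
  eqPhi x y -> eqPhi x^-1 y^-1.
Proof.
move=> x0 y0 lx ly [_ _ h]; split=> //.
have -> : x^-1 - y^-1 = (x - y) * (- x^-1 * y^-1) by field; rewrite x0 y0.
by apply: idealPhiM h _; apply: localM => //; apply: localN.
Qed.

Lemma eqPhiX x y k : eqPhi x y -> eqPhi (x ^+ k) (y ^+ k).
Proof.
move=> h; elim: k => [|k IHk]; first exact/eqPhi_refl/local1.
by rewrite !exprS; apply: eqPhiM.
Qed.

Lemma eqPhi_prod l m (f g : nat -> F) :
  (forall i, (l <= i < m)%N -> eqPhi (f i) (g i)) ->
  eqPhi (\prod_(l <= i < m) f i) (\prod_(l <= i < m) g i).
Proof.
move=> fg; rewrite big_nat_cond [X in eqPhi _ X]big_nat_cond.
apply: (big_ind2 eqPhi) => [||i /andP[]//]; first exact/eqPhi_refl/local1.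
  by move=> *; apply: eqPhiM.
by move=> hi _; apply: fg.
Qed.

Lemma qvarMn_eqPhi1 c : eqPhi (q ^+ (c * n)) 1.
Proof.
have h : eqPhi 1 (q ^+ n).
  split; [exact: local1 | exact: localX local_qvar | exact: idealPhi_1subXn].
by rewrite mulnC exprM -[X in eqPhi _ X](expr1n _ c); apply/eqPhiX/eqPhi_sym.
Qed.

(** * Congruence of the individual terms *)

Section TermCongruence.

Variables (c b j : nat).
Hypotheses (c_gt0 : (0 < c)%N) (j_gt0 : (0 < j)%N) (le_jn : (j <= n./2)%N).

Let local_q k : local (q ^+ k). Proof. exact: localX local_qvar. Qed.

(* The common value, up to sign, of A_j ([ratio_term]) and B_j ([luc_term],
   which includes the factor (-1)^j p^(j(j-1)/2)) once q^n is replaced by 1. *)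
Definition middle_term : F :=
  (-1) ^+ j * q ^+ j
  * \prod_(1 <= i < j) (- (1 - q ^+ (j + i)) / (1 - q ^+ i)) / (1 - q ^+ j).

Definition ratio_term : F :=
  (-1) ^+ j * q ^+ (j ^ 2)%N * p ^+ (2 * (c * n) * j)
  * \prod_(1 <= i < j)
      ((1 - q ^+ (2 * (c * n - i))) * (1 - q ^+ (2 * (b * n) + j + i))
       / ((1 - q ^+ (2 * (b * n + i))) * (1 - q ^+ i)))
  / (1 - q ^+ j).

Definition luc_term : F :=
  (-1) ^+ j * p ^+ 'C(j, 2)
  * (\prod_(1 <= i < j) (1 - p ^+ (n - j - i)) / \prod_(1 <= i < j.+1) (1 - p ^+ i)).

Lemma exprD_eqPhi k m : eqPhi (q ^+ (k * n + m)) (q ^+ m).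
Proof.
rewrite exprD -[X in eqPhi _ X]mul1r.
by apply: eqPhiM; [apply: qvarMn_eqPhi1 | apply: eqPhi_refl].
Qed.

Lemma qvarVMn_eqPhi1 k : eqPhi (p ^+ (k * n)) 1.
Proof.
rewrite exprVn -invr1; apply: eqPhiV; rewrite ?oner_eq0 ?invr1 ?expf_neq0 ?qvar_neq0 //.
- by rewrite -exprVn; apply/localX/local_qvarV.
- exact: local1.
- exact: qvarMn_eqPhi1.
Qed.

Lemma ndvd_small i : (0 < i < n)%N -> ~~ (n %| i)%N.
Proof. by case/andP=> i_gt0 lt_in; rewrite gtnNdvd. Qed.

(** From j^2 = j + 2(1 + ... + (j-1)); each factor of [ratio_term] receives one q^(2i). *)
Lemma qvar_sq_prod : q ^+ (j ^ 2)%N = q ^+ j * \prod_(1 <= i < j) q ^+ (2 * i).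
Proof.
case: j j_gt0 => // j' _; elim: j' => [|k IHk]; first by rewrite big_geq // mulr1.
have -> : (k.+2 ^ 2 = k.+1 ^ 2 + 1 + 2 * k.+1)%N by lia.
by rewrite !exprD IHk [in RHS]big_nat_recr //= [q ^+ k.+2]exprS; ring.
Qed.

Lemma qvarV_bin_prod : p ^+ 'C(j, 2) = \prod_(1 <= i < j) p ^+ i.
Proof.
case: j j_gt0 => // j' _; elim: j' => [|k IHk]; first by rewrite big_geq.
by rewrite big_nat_recr //= -IHk -exprD binS bin1.
Qed.

(** With q^n replaced by 1, q^(2i) (1 - q^(-2i)) / (1 - q^(2i)) is -1. The bound j <= n/2 gives 0 <
    2i < n for 0 < i < j, so 1 - q^(2i) is invertible modulo [Phi]. *)
Lemma ratio_term_eqPhi : eqPhi ratio_term middle_term.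
Proof.
rewrite /ratio_term /middle_term qvar_sq_prod.
have -> : forall x y z w t : F, x * (y * z) * w * t = x * y * w * (z * t).
  by move=> *; ring.
rewrite -big_split /=; apply: eqPhiM; last first.
  by apply/eqPhi_refl/local_unit => //; apply: ndvd_small; lia.
apply: eqPhiM.
  rewrite -[X in eqPhi _ X]mulr1; apply: eqPhiM.
    by apply: eqPhi_refl; apply: localM => //; apply/localX/localN/local1.
  have -> : (2 * (c * n) * j = 2 * c * j * n)%N by lia.
  exact: qvarVMn_eqPhi1.
apply: eqPhi_prod => i /andP[i_gt0 lt_ij].
have le_i : (2 * i <= 2 * (c * n))%N by nia.
have qP := not_unity_root_qvar.
have n2i : ~~ (n %| 2 * i)%N by apply: ndvd_small; lia.
(* Each exponent is brought to the form k n + m of [exprD_eqPhi]; q^(2i) is absorbed into the first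
   factor. *)
have -> : q ^+ (2 * i) * ((1 - q ^+ (2 * (c * n - i))) * (1 - q ^+ (2 * (b * n) + j + i)) /
    ((1 - q ^+ (2 * (b * n + i))) * (1 - q ^+ i)))
  = (q ^+ (2 * i) - q ^+ (2 * c * n + 0)) * (1 - q ^+ (2 * b * n + (j + i)))
    * (1 - q ^+ (2 * b * n + 2 * i))^-1 * (1 - q ^+ i)^-1.
  have -> : (2 * c * n + 0 = 2 * i + 2 * (c * n - i))%N by lia.
  have -> : (2 * (b * n + i) = 2 * b * n + 2 * i)%N by lia.
  have -> : (2 * (b * n) + j + i = 2 * b * n + (j + i))%N by lia.
  by rewrite (exprD _ (2 * i)) invfM; ring.
have -> : - (1 - q ^+ (j + i)) / (1 - q ^+ i)
  = (q ^+ (2 * i) - q ^+ 0) * (1 - q ^+ (j + i)) * (1 - q ^+ (2 * i))^-1 * (1 - q ^+ i)^-1.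
  have h1 : 1 - q ^+ (2 * i) != 0 by apply: qP; lia.
  have h2 : 1 - q ^+ i != 0 by apply: qP.
  by rewrite expr0; field; rewrite h1 h2.
have r1 : eqPhi 1 1 by apply/eqPhi_refl/local1.
apply: eqPhiM; last by apply/eqPhi_refl/local_unit => //; apply: ndvd_small; lia.
apply: eqPhiM.
  apply: eqPhiM; first by apply: eqPhiB; [apply: eqPhi_refl | apply: exprD_eqPhi].
  by apply: eqPhiB r1 _; apply: exprD_eqPhi.
apply: eqPhiV; try (by apply: qP; lia); try exact: local_unit.
  by apply: local_unit => //; rewrite dvdn_addr // dvdn_mull.
by apply: eqPhiB r1 _; apply: exprD_eqPhi.
Qed.

(** Since 1/(1 - p^i) = - q^i / (1 - q^i), the powers q^i with i < j cancel p^C(j,2), and i = j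
    leaves - q^j. Then p^(n-j-i) = p^n q^(j+i) is congruent to q^(j+i). *)
Lemma luc_term_eqPhi : eqPhi luc_term (- middle_term).
Proof.
have q0 : q != 0 := qvar_neq0.
have qP := not_unity_root_qvar.
have -> : luc_term = - ((-1) ^+ j * q ^+ j
  * \prod_(1 <= i < j) (- (1 - p ^+ (n - j - i)) / (1 - q ^+ i)) / (1 - q ^+ j)).
  have pj : (1 - p ^+ j)^-1 = - q ^+ j / (1 - q ^+ j).
    have h1 : q ^+ j != 0 by rewrite expf_neq0.
    have h2 := qP _ j_gt0; have h3 : q ^+ j - 1 != 0 by rewrite -opprB oppr_eq0.
    by rewrite exprVn -/q; field; rewrite ?h1 ?h2 ?h3.
  rewrite /luc_term [X in _ / X]big_nat_recr //= invfM pj mulrA -prodf_div.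
  rewrite qvarV_bin_prod -mulrA [X in _ * X]mulrA -big_split /=.
  have -> : \prod_(1 <= i < j) (p ^+ i * ((1 - p ^+ (n - j - i)) / (1 - p ^+ i)))
    = \prod_(1 <= i < j) (- (1 - p ^+ (n - j - i)) / (1 - q ^+ i)).
    apply: eq_big_nat => i /andP[i_gt0 _].
    move: (p ^+ (n - j - i)) => x.
    have h1 : q ^+ i != 0 by rewrite expf_neq0.
    have h2 := qP _ i_gt0; have h3 : q ^+ i - 1 != 0 by rewrite -opprB oppr_eq0.
    by rewrite exprVn -/q; field; rewrite ?h1 ?h2 ?h3.
  by ring.
apply/eqPhiN/eqPhiM; last by apply/eqPhi_refl/local_unit => //; apply: ndvd_small; lia.
apply: eqPhiM; first by apply: eqPhi_refl; apply: localM => //; apply/localX/localN/local1.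
apply: eqPhi_prod => i /andP[i_gt0 lt_ij]; apply: eqPhiM; last first.
  by apply/eqPhi_refl/local_unit => //; apply: ndvd_small; lia.
apply/eqPhiN/eqPhiB; first exact/eqPhi_refl/local1.
have -> : p ^+ (n - j - i) = p ^+ (1 * n) * q ^+ (j + i).
  have -> : (1 * n = n - j - i + (j + i))%N by lia.
  by rewrite exprD -mulrA -exprMn mulVf // expr1n mulr1.
rewrite -[X in eqPhi _ X]mul1r.
by apply: eqPhiM; [apply: qvarVMn_eqPhi1 | apply: eqPhi_refl].
Qed.

(** Both summands contain 1 - q^n, because 1 - p^n = - p^n (1 - q^n); the cofactor is congruent to
    2c - 2c = 0. *)
Lemma idealPhi2_1subX :
  idealPhi 2 (1 - q ^+ (2 * (c * n)) + (2 * c)%:R * (1 - p ^+ n)).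
Proof.
have -> : 1 - q ^+ (2 * (c * n)) + (2 * c)%:R * (1 - p ^+ n)
  = (1 - q ^+ n) * (\sum_(i < 2 * c) q ^+ n ^+ i - (2 * c)%:R * p ^+ n).
  have := subrX1 (q ^+ n) (2 * c); rewrite -exprM => h.
  have qpn : q ^+ n * p ^+ n = 1 by rewrite -exprMn mulfV ?expr1n ?qvar_neq0.
  rewrite [in RHS]mulrBr.
  have -> : (1 - q ^+ n) * \sum_(i < 2 * c) q ^+ n ^+ i = 1 - q ^+ (n * (2 * c)).
    by rewrite -[RHS]opprB h -mulNr opprB.
  have -> : (n * (2 * c) = 2 * (c * n))%N by lia.
  by rewrite mulrCA [(1 - _) * p ^+ n]mulrBl qpn; ring.
apply: (idealPhi_mul (k := 1) (l := 1)); first exact: idealPhi_1subXn.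
suff [] : eqPhi (\sum_(i < 2 * c) q ^+ n ^+ i - (2 * c)%:R * p ^+ n)
  ((2 * c)%:R - (2 * c)%:R * 1) by rewrite mulr1 subrr subr0.
have lc : local (2 * c)%:R by exact: (local_int (2 * c)%N).
apply: eqPhiB; last first.
  apply: eqPhiM; first exact: eqPhi_refl.
  by rewrite -[X in p ^+ X]mul1n; apply: qvarVMn_eqPhi1.
have -> : (2 * c)%:R = \sum_(i < 2 * c) 1 :> F by rewrite sumr_const card_ord.
apply: (big_ind2 eqPhi) => [||i _]; first exact/eqPhi_refl/local0.
  by move=> *; apply: eqPhiD.
by rewrite -exprM mulnC; apply: qvarMn_eqPhi1.
Qed.

(** With u = 1 - q^(2cn) and v = 2c (1 - p^n), one has u A - v B = (u + v) A - v (A + B). Here u + v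
    lies in the square of the ideal, while v and A + B each lie in the ideal. *)
Lemma term_eqPhi2 :
  idealPhi 2 ((1 - q ^+ (2 * (c * n))) * ratio_term
                - (2 * c)%:R * ((1 - p ^+ n) * luc_term)).
Proof.
have [lr lm hr] := ratio_term_eqPhi; have [ll _ hl] := luc_term_eqPhi.
have -> : (1 - q ^+ (2 * (c * n))) * ratio_term - (2 * c)%:R * ((1 - p ^+ n) * luc_term)
  = (1 - q ^+ (2 * (c * n)) + (2 * c)%:R * (1 - p ^+ n)) * ratio_term
    + (1 - p ^+ n) * (ratio_term - middle_term + (luc_term - - middle_term))
      * - (2 * c)%:R by ring.
apply: idealPhiD; first exact: idealPhiM idealPhi2_1subX lr.
apply: idealPhiM; last by apply/localN; exact: (local_int (2 * c)%N).
apply: (idealPhi_mul (k := 1) (l := 1)); last exact: idealPhiD.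
have [_ _] := qvarVMn_eqPhi1 1; rewrite mul1n => h.
by rewrite -[1 - _]opprB -mulrN1; apply: idealPhiM h _; apply/localN/local1.
Qed.

End TermCongruence.

(** * Assembly of the congruence *)

Lemma qluc_qvarV : qluc p n = 1 + \sum_(1 <= j < n./2.+1) (1 - p ^+ n) * luc_term j.
Proof.
have pP := not_unity_root_qvarV.
rewrite /qluc (big_cat_nat (n := n./2.+1)) //=; last by lia.
rewrite [X in _ + X]big_nat_cond [X in _ + X]big1 ?addr0; last first.
  by move=> j /andP[/andP[lt_j _] _]; rewrite qbinom_small ?mulr0 //; lia.
rewrite big_ltn // qbinomn0 subn0 divff ?pP // !mulr1; congr (_ + _).
apply: eq_big_nat => j /andP[j_gt0 le_j].
rewrite /luc_term /qbinom ifT; last by lia.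
(* The leading numerator factor 1 - p^(n-j) cancels the denominator in [qluc]. *)
rewrite big_ltn // subn0.
have h1 : 1 - p ^+ (n - j) != 0 by apply: pP; lia.
have := qfact_neq0 pP j; rewrite /qfact => h2.
by field; rewrite ?h1 ?h2.
Qed.

Lemma t0'_idealPhi2 a b : (b < a)%N ->
  idealPhi 2 (t0' a b n q
    - (-1) ^+ (a * n - b * n) * q ^+ ((a * n - b * n) ^ 2)%N
      * qbinom (q ^+ 2) (a * n) (b * n)
      * (1 - 2%:R * (a%:R - b%:R) * (1 - theta n p))).
Proof.
move=> b_lt_a.
have [c c_gt0 def_a] : exists2 c, (0 < c)%N & a = (b + c)%N.
  by exists (a - b)%N; lia.
rewrite {a b_lt_a}def_a natrD.
rewrite [_ + _ - _ in X in _ - X]addrAC subrr add0r -natrM.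
rewrite -(qlucE not_unity_root_qvarV) // qluc_qvarV // opprD addNKr mulrN opprK.
rewrite /t0' mulnDl addKn; set M := (c * n)%N.
have le_nM : (n./2 <= M)%N by rewrite /M; nia.
set T0 := (-1) ^+ M * _ * _.
have -> : \sum_(M - n./2 <= k < M.+1)
     (-1) ^+ k * q ^+ (k ^ 2)%N * qbinom (q ^+ 2) (b * n + M) k
     * qbinom q (2 * (b * n + M) - 2 * k) (M - k)
  = T0 * (1 + \sum_(1 <= j < n./2.+1) (1 - q ^+ (2 * M)) * ratio_term c b j).
  rewrite -{1}[(M - n./2)%N]add0n big_addn subSn ?leq_subr // subKn //.
  rewrite big_nat_rev /= big_ltn // mulrDr big_distrr /= mulr1; congr (_ + _).
    have -> : (0 + n./2.+1 - 1 + (M - n./2) = M)%N by lia.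
    rewrite subnn qbinomn0 mulr1 /T0; congr (_ * _).
    (* For j = 0 the lower index is M, while [T0] has bn: symmetry of the q-binomial. *)
    have q2P := not_unity_root_qvar2; rewrite !(qbinom_qfact q2P); try lia.
    by rewrite addnK addKn [qfact _ M * _]mulrC.
  apply: eq_big_nat => j /andP[j_gt0 le_j].
  have -> : (0 + n./2.+1 - j.+1 + (M - n./2) = M - j)%N by lia.
  rewrite qbinom_term_ratio //; last by lia.
  - exact: qvar_neq0.
  - exact: not_unity_root_qvar.
  - exact: not_unity_root_qvar2.
(* The common factor [T0] is local, so only the difference of the two brackets has to lie in the
   ideal; their constant terms 1 cancel. *)
rewrite -mulrBr mulrC; apply: idealPhiM; last first.
  apply: localM; last exact: local_qbinom2.
  by apply: localM; apply: localX; [apply/localN/local1 | apply: local_qvar].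
rewrite opprD addrACA subrr add0r big_distrr /= -sumrB; apply: idealPhi_sum => // j.
by rewrite mem_index_iota => /andP[j_gt0 le_j]; apply: term_eqPhi2.
Qed.

End LocalRing.

Theorem theorem1p6 (a b n : nat)
    (a_gt0 : (0 < a)%N) (b_gt0 : (0 < b)%N) (n_gt0 : (0 < n)%N)
    (b_lt_a : (b < a)%N) :
  eqmod_Phi2 n
    (t0' a b n qvar)
    ((-1) ^+ (a * n - b * n) * qvar ^+ ((a * n - b * n) ^ 2)%N
     * qbinom (qvar ^+ 2) (a * n) (b * n)
     * (1 - 2%:R * (a%:R - b%:R) * (1 - theta n (qvar^-1)))).
Proof.
pose emb : {rmorphism {poly int} -> ratfun} := @FracField.tofrac {poly int}.
have emb_inj : injective emb by move=> P Q /eqP; rewrite tofrac_eq => /eqP.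
have [_ [P [Q [cQ ->]]] h] := t0'_idealPhi2 emb_inj n_gt0 b_lt_a.
by exists P, Q; split=> //; rewrite tofracXn -[RHS]mulrA; exact: h.
Qed.
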